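(* Let $A, B\in \mathbb{C}^{m\times n}$ be such that $A^*B=0$ (that is, $A$ is left $*$-orthogonal to $B$) and $\mathcal{R}(A^* )\cap \mathcal{R}(B^* )=\{0\}$. Then $$(A+B)^\dagger=\left([(\overline{P}_{A^*} B^* )(\overline{P}_{A^*} B^* )^*]^\dagger+[(\overline{P}_{B^*} A^* )(\overline{P}_{B^*} A^* )^*]^\dagger\right)(A+B)^*.$$
   Context: $M^*$ is the conjugate transpose, $\mathcal{R}(M)$ the column space, and $M^\dagger$ the Moore-Penrose inverse of $M$. For a matrix $M$ with $k$ rows, $\overline{P}_M=I_k-MM^\dagger$; in particular $\overline{P}_{A^*}=I_n-A^*(A^* )^\dagger$ and $\overline{P}_{B^*}=I_n-B^*(B^* )^\dagger$. *)

(* Defs.v *)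
From mathcomp Require Import all_boot all_order all_algebra.
From mathcomp Require Import all_classical reals.
From mathcomp Require Import complex.

Set Implicit Arguments.
Unset Strict Implicit.
Unset Printing Implicit Defensive.

Import Order.TTheory GRing.Theory Num.Theory.

Local Open Scope ring_scope.
Local Open Scope sesquilinear_scope.
Local Open Scope classical_set_scope.

Section MoorePenrose.
Variable C : numClosedFieldType.

(* The library notation [M ^t*] is the conjugate transpose of [M]. *)

(* The four Penrose equations. *)
Definition is_mpinv m n (M : 'M[C]_(m, n)) (X : 'M[C]_(n, m)) : bool :=
  [&& M *m X *m M == M,
      X *m M *m X == X,
      (M *m X) ^t* == M *m X &
      (X *m M) ^t* == X *m M].

Lemma ctrmx_mul m n p (M : 'M[C]_(m, n)) (N : 'M[C]_(n, p)) :
  (M *m N) ^t* = N ^t* *m M ^t*.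
Proof. by rewrite trmx_mul map_mxM. Qed.

Lemma mulmx_ctrmx_eq0 m n (M : 'M[C]_(m, n)) : M *m M ^t* = 0 -> M = 0.
Proof.
move=> M0; apply/matrixP => i j; rewrite mxE.
have /eqP := congr1 (fun N : 'M_m => N i i) M0; rewrite !mxE psumr_eq0.
  by move=> /allP /(_ j (mem_index_enum j)); rewrite !mxE mul_conjC_eq0 => /eqP.
by move=> k _; rewrite !mxE mul_conjC_ge0.
Qed.

Lemma row_free_gram_unit r n (G : 'M[C]_(r, n)) :
  row_free G -> G *m G ^t* \in unitmx.
Proof.
move=> freeG; rewrite -row_free_unit -kermx_eq0; apply/eqP.
apply: (row_free_inj freeG); rewrite mul0mx; apply: mulmx_ctrmx_eq0.
by rewrite ctrmx_mul mulmxA -(mulmxA _ G) mulmx_ker mul0mx.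
Qed.

Lemma mpinv_exists m n (M : 'M[C]_(m, n)) : exists X, is_mpinv M X.
Proof.
have [r [F [G [MFG uF uG]]]] : exists r (F : 'M_(m, r)) (G : 'M_(r, n)),
    [/\ M = F *m G, F ^t* *m F \in unitmx & G *m G ^t* \in unitmx].
  exists (\rank M), (col_base M), (row_base M); split.
  - by rewrite mulmx_base.
  - rewrite -{2}(trmxCK (col_base M)); apply: row_free_gram_unit.
    by rewrite /row_free mxrank_map mxrank_tr; exact: col_base_full.
  - by rewrite row_free_gram_unit ?row_base_free.
pose F' := invmx (F ^t* *m F) *m F ^t*.
pose G' := G ^t* *m invmx (G *m G ^t*).
have F'F : F' *m F = 1%:M by rewrite /F' -mulmxA mulVmx.
have GG' : G *m G' = 1%:M by rewrite /G' mulmxA mulmxV.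
have hinv (U : 'M[C]_r) : U ^t* = U -> (invmx U) ^t* = invmx U.
  by move=> UU; rewrite trmx_inv map_invmx UU.
have hF : (F *m F') ^t* = F *m F'.
  by rewrite /F' !ctrmx_mul trmxCK hinv ?ctrmx_mul ?trmxCK // mulmxA.
have hG : (G' *m G) ^t* = G' *m G.
  by rewrite /G' !ctrmx_mul trmxCK hinv ?ctrmx_mul ?trmxCK // mulmxA.
have MX : M *m (G' *m F') = F *m F'.
  by rewrite MFG mulmxA -(mulmxA F) GG' mulmx1.
have XM : (G' *m F') *m M = G' *m G.
  by rewrite MFG mulmxA -(mulmxA G') F'F mulmx1.
exists (G' *m F'); rewrite /is_mpinv MX XM hF hG !eqxx !andbT.
apply/andP; split; apply/eqP.
  by rewrite {1 2}MFG mulmxA -(mulmxA F) F'F mulmx1.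
by rewrite mulmxA -(mulmxA G') GG' mulmx1.
Qed.

Lemma is_mpinv_uniq m n (M : 'M[C]_(m, n)) X Y :
  is_mpinv M X -> is_mpinv M Y -> X = Y.
Proof.
move=> /and4P[/eqP MXM /eqP XMX /eqP hMX /eqP hXM].
move=> /and4P[/eqP MYM /eqP YMY /eqP hMY /eqP hYM].
have eMX : M *m X = M *m Y.
  by rewrite -hMX -{1}MYM -(mulmxA (M *m Y)) ctrmx_mul hMX hMY mulmxA MXM.
have eXM : X *m M = Y *m M.
  by rewrite -hXM -{1}MYM -(mulmxA M) mulmxA ctrmx_mul hXM hYM -mulmxA
             (mulmxA M) MXM.
by rewrite -XMX eXM -mulmxA eMX mulmxA.
Qed.

(* The Moore-Penrose inverse, not the one-sided [pinvmx] of mxalgebra. *)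
Definition mpinv m n (M : 'M[C]_(m, n)) : 'M[C]_(n, m) :=
  xchoose (mpinv_exists M).

Lemma mpinvP m n (M : 'M[C]_(m, n)) : is_mpinv M (mpinv M).
Proof. exact: xchooseP. Qed.

Definition mpcoproj k l (M : 'M[C]_(k, l)) : 'M[C]_k :=
  1%:M - M *m mpinv M.

(* Column vectors, as in the mathematics; the subspaces of mxalgebra are row
   spaces. *)
Definition colspace k l (M : 'M[C]_(k, l)) : set 'cV[C]_k :=
  [set M *m x | x in [set: 'cV[C]_l]].

End MoorePenrose.

(* Main.v *)
(** If [C := B *m mpcoproj (A ^t* )] and [D := A *m mpcoproj (B ^t* )], then
    [(C^* C)^+ = C^+ (C^+)^*], [A C^+ = 0] and [B C^+ = C C^+], so the
    right-hand side collapses to [C^+ + D^+]; symmetrically in [A] and [B].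
    Disjointness of the row spaces gives [C C^+ B = B] and [D D^+ A = A], from
    which the first three Penrose equations for [C^+ + D^+] follow.  For the
    fourth, [A^* B = 0] puts the columns of [A^*] and [B^*], hence those of
    [C^+ + D^+], inside the column space of [(A + B)^*]. *)

Require Import Defs.
From mathcomp Require Import all_boot all_order all_algebra.
From mathcomp Require Import all_classical reals complex.

Local Open Scope ring_scope.
Local Open Scope sesquilinear_scope.
Local Open Scope classical_set_scope.

Import GRing.Theory.

Section MoorePenroseTheory.
Variable C : numClosedFieldType.

Lemma ctrmxD {m n} (M N : 'M[C]_(m, n)) : (M + N) ^t* = M ^t* + N ^t*.
Proof. by rewrite linearD /= map_mxD. Qed.

Lemma ctrmxB {m n} (M N : 'M[C]_(m, n)) : (M - N) ^t* = M ^t* - N ^t*.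
Proof. by rewrite linearB /= map_mxB. Qed.

Lemma ctrmx0 {m n} : (0 : 'M[C]_(m, n)) ^t* = 0.
Proof. by rewrite trmx0 map_mx0. Qed.

Lemma ctrmx1 {n} : (1%:M : 'M[C]_n) ^t* = 1%:M.
Proof. by rewrite trmx1 map_mx1. Qed.

Lemma ctr_orthoC {m n} (A B : 'M[C]_(m, n)) : A ^t* *m B = 0 -> B ^t* *m A = 0.
Proof. by move=> AB0; rewrite -[LHS]trmxCK ctrmx_mul trmxCK AB0 ctrmx0. Qed.

(** * Consequences of the Penrose equations *)

Lemma mulmx_mpinvK {m n} (M : 'M[C]_(m, n)) : M *m mpinv M *m M = M.
Proof. by have /and4P[/eqP] := mpinvP M. Qed.

Lemma mpinv_mulmxK {m n} (M : 'M[C]_(m, n)) :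
  mpinv M *m M *m mpinv M = mpinv M.
Proof. by have /and4P[_ /eqP] := mpinvP M. Qed.

Lemma mulmx_mpinv_ctr {m n} (M : 'M[C]_(m, n)) :
  (M *m mpinv M) ^t* = M *m mpinv M.
Proof. by have /and4P[_ _ /eqP] := mpinvP M. Qed.

Lemma mpinv_mulmx_ctr {m n} (M : 'M[C]_(m, n)) :
  (mpinv M *m M) ^t* = mpinv M *m M.
Proof. by have /and4P[_ _ _ /eqP] := mpinvP M. Qed.

Lemma mpinv_eq {m n} (M : 'M[C]_(m, n)) X : is_mpinv M X -> mpinv M = X.
Proof. exact: is_mpinv_uniq (mpinvP M). Qed.

Lemma mulmx_ctr_mpinvK {m n} (M : 'M[C]_(m, n)) :
  M ^t* *m (M *m mpinv M) = M ^t*.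
Proof. by rewrite -mulmx_mpinv_ctr -ctrmx_mul mulmx_mpinvK. Qed.

(** Used to place the columns of [mpinv M] in the column space of [M ^t*]; [mpinv_ctrr] is the
    counterpart for rows. *)
Lemma mpinv_ctrl {m n} (M : 'M[C]_(m, n)) :
  mpinv M = M ^t* *m ((mpinv M) ^t* *m mpinv M).
Proof. by rewrite mulmxA -ctrmx_mul mpinv_mulmx_ctr mpinv_mulmxK. Qed.

Lemma mpinv_ctrr {m n} (M : 'M[C]_(m, n)) :
  mpinv M = mpinv M *m (mpinv M) ^t* *m M ^t*.
Proof. by rewrite -mulmxA -ctrmx_mul mulmx_mpinv_ctr mulmxA mpinv_mulmxK. Qed.

(** Both products of the Gram matrix with the candidate collapse to the Hermitian projector
    [mpinv M *m M]. *)
Lemma mpinv_gram {m n} (M : 'M[C]_(m, n)) :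
  mpinv (M ^t* *m M) = mpinv M *m (mpinv M) ^t*.
Proof.
have MX : M ^t* *m M *m (mpinv M *m (mpinv M) ^t*) = mpinv M *m M.
  by rewrite mulmxA -(mulmxA _ M) mulmx_ctr_mpinvK -ctrmx_mul mpinv_mulmx_ctr.
have XM : mpinv M *m (mpinv M) ^t* *m (M ^t* *m M) = mpinv M *m M.
  by rewrite mulmxA -mpinv_ctrr.
apply: mpinv_eq; rewrite /is_mpinv MX XM mpinv_mulmx_ctr !eqxx !andbT.
apply/andP; split; apply/eqP; last by rewrite mulmxA mpinv_mulmxK.
by rewrite -mpinv_mulmx_ctr mulmxA -ctrmx_mul mulmxA mulmx_mpinvK.
Qed.

(** * Orthogonal projectors onto complements of column spaces *)

Lemma mpcoproj_ctr {k l} (M : 'M[C]_(k, l)) : (mpcoproj M) ^t* = mpcoproj M.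
Proof. by rewrite /mpcoproj ctrmxB ctrmx1 mulmx_mpinv_ctr. Qed.

Lemma mpcoproj_mulmx {k l} (M : 'M[C]_(k, l)) : mpcoproj M *m M = 0.
Proof. by rewrite /mpcoproj mulmxBl mul1mx mulmx_mpinvK subrr. Qed.

Lemma mpcoproj_idem {k l} (M : 'M[C]_(k, l)) :
  mpcoproj M *m mpcoproj M = mpcoproj M.
Proof.
by rewrite {2}/mpcoproj mulmxBr mulmx1 mulmxA mpcoproj_mulmx mul0mx subr0.
Qed.

Lemma mulmx_mpcoproj_ctr {m n} (A : 'M[C]_(m, n)) :
  A *m mpcoproj (A ^t*) = 0.
Proof.
by rewrite -[LHS]trmxCK ctrmx_mul mpcoproj_ctr mpcoproj_mulmx ctrmx0.
Qed.

(** * Restriction of [B] to the kernel of [A], onto which [Q] projects *)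

Section Restriction.
Context {m n : nat} (A B : 'M[C]_(m, n)).
Let Q := mpcoproj (A ^t*).
Let BQ := B *m Q.

(** The columns of [mpinv BQ] lie in the column space of [BQ ^t* = Q *m B ^t*], which [Q] fixes. *)
Lemma mpcoproj_mul_mpinv : Q *m mpinv BQ = mpinv BQ.
Proof.
have QBQ : Q *m BQ ^t* = BQ ^t*.
  by rewrite ctrmx_mul mpcoproj_ctr mulmxA mpcoproj_idem.
by rewrite mpinv_ctrl mulmxA QBQ.
Qed.

Lemma mulmx_mpinv_restr0 : A *m mpinv BQ = 0.
Proof.
by rewrite -mpcoproj_mul_mpinv mulmxA mulmx_mpcoproj_ctr mul0mx.
Qed.

Lemma mulmx_mpinv_restr : B *m mpinv BQ = BQ *m mpinv BQ.
Proof. by rewrite -{1}mpcoproj_mul_mpinv mulmxA. Qed.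

(** By [mpinv_ctrr], [mpinv BQ] has the right factor [BQ ^t*], which ends in [B ^t*], and [B ^t*]
    annihilates [A]. *)
Lemma mpinv_restr_mulmx0 : A ^t* *m B = 0 -> mpinv BQ *m A = 0.
Proof.
move=> /ctr_orthoC BA0.
by rewrite mpinv_ctrr /BQ ctrmx_mul -!mulmxA BA0 !mulmx0.
Qed.

Lemma mpinv_gram_restr :
  mpinv (Q *m B ^t* *m (Q *m B ^t*) ^t*) *m (A + B) ^t* = mpinv BQ.
Proof.
have -> : Q *m B ^t* = BQ ^t* by rewrite /BQ ctrmx_mul mpcoproj_ctr.
rewrite trmxCK mpinv_gram -mulmxA -ctrmx_mul mulmxDl mulmx_mpinv_restr0 add0r.
by rewrite mulmx_mpinv_restr mulmx_mpinv_ctr mulmxA mpinv_mulmxK.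
Qed.

(* The columns of [(B - BQ BQ^+ B)^*] lie in both column spaces. *)
Lemma mulmx_mpinv_restrK :
    colspace (A ^t*) `&` colspace (B ^t*) = [set 0] ->
  BQ *m mpinv BQ *m B = B.
Proof.
move=> cap; pose K := B - BQ *m mpinv BQ *m B.
have KQ : K *m Q = 0.
  by rewrite mulmxBl -[_ *m B *m Q]mulmxA mulmx_mpinvK subrr.
(* Since [Q] kills [K ^t*], the projector onto the column space of [A ^t*] fixes it. *)
have KA : K ^t* = A ^t* *m (mpinv (A ^t*) *m K ^t*).
  have : Q *m K ^t* = 0 by rewrite -[Q]mpcoproj_ctr -ctrmx_mul KQ ctrmx0.
  by rewrite /Q /mpcoproj mulmxBl mul1mx mulmxA => /eqP; rewrite subr_eq0 => /eqP.
have KB : K ^t* = B ^t* *m (1%:M - BQ *m mpinv BQ).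
  by rewrite ctrmxB ctrmx_mul mulmx_mpinv_ctr mulmxBr mulmx1.
have K0 : K ^t* = 0.
  apply/matrixP => i j; have : [set 0] (col j (K ^t*)).
    rewrite -cap; split.
      by rewrite KA colE -mulmxA; eexists.
    by rewrite KB colE -mulmxA; eexists.
  by move=> /= /matrixP /(_ i 0); rewrite !mxE.
by apply/esym/eqP; rewrite -subr_eq0 -/K -[K]trmxCK K0 ctrmx0.
Qed.

End Restriction.

(** * Factoring through [(A + B) ^t*] *)

Lemma mulmx_ctr_add {m n} (A B : 'M[C]_(m, n)) :
  A ^t* *m B = 0 -> (A + B) ^t* *m (A *m mpinv A) = A ^t*.
Proof.
move=> /ctr_orthoC BA0.
by rewrite ctrmxD mulmxDl mulmx_ctr_mpinvK mulmxA BA0 mul0mx addr0.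
Qed.

Lemma mpinv_restr_ctr_factor {m n} (A B : 'M[C]_(m, n)) : A ^t* *m B = 0 ->
  exists W, mpinv (B *m mpcoproj (A ^t*)) = (A + B) ^t* *m W.
Proof.
move=> AB0; have eA := mulmx_ctr_add A B AB0.
have eB := mulmx_ctr_add B A (ctr_orthoC _ _ AB0); rewrite addrC in eB.
rewrite mpinv_ctrl ctrmx_mul mpcoproj_ctr /mpcoproj mulmxBl mul1mx -mulmxA.
move: (mpinv (A ^t*) *m _) (_ *m mpinv _) => T V.
(* The left-hand side is now [(B ^t* - A ^t* *m T) *m V]; by [eB] and [eA], both [B ^t*] and [A ^t*]
   are right multiples of [(A + B) ^t*]. *)
exists ((B *m mpinv B - A *m mpinv A *m T) *m V).
by rewrite mulmxA mulmxBr eB mulmxA eA.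
Qed.

(** Put [N := M ^t* *m W *m M]. As [N ^t*] ends in [M] and [M *m N = M], one gets
    [N ^t* *m N = N ^t*]; the left side is Hermitian, hence so is [N]. *)
Lemma mulmx_ctr_idem_herm {m n} (M : 'M[C]_(m, n)) W :
  M *m (M ^t* *m W) *m M = M ->
  (M ^t* *m W *m M) ^t* = M ^t* *m W *m M.
Proof.
rewrite -mulmxA => MN; set N := M ^t* *m W *m M in MN *.
have NN : N ^t* *m N = N ^t*.
  have -> : N ^t* = M ^t* *m W ^t* *m M by rewrite !ctrmx_mul trmxCK mulmxA.
  by rewrite -mulmxA MN.
by clearbody N; rewrite -[RHS]trmxCK -NN ctrmx_mul trmxCK.
Qed.

(** * Assembling the inverse of the sum *)

(** All cross terms vanish. The projectors [X *m A] and [Y *m B] may be oblique, so the fourth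
    Penrose equation comes from the factorization through [(A + B) ^t*]. *)
Lemma is_mpinv_add {m n} (A B : 'M[C]_(m, n)) X Y W :
    A *m Y = 0 -> B *m X = 0 -> X *m B = 0 -> Y *m A = 0 ->
    A *m X *m A = A -> B *m Y *m B = B -> X *m A *m X = X -> Y *m B *m Y = Y ->
    (A *m X) ^t* = A *m X -> (B *m Y) ^t* = B *m Y ->
    X + Y = (A + B) ^t* *m W ->
  is_mpinv (A + B) (X + Y).
Proof.
move=> AY BX XB YA AXA BYB XAX YBY hAX hBY eXY.
have MX : (A + B) *m (X + Y) = A *m X + B *m Y.
  by rewrite mulmxDl !mulmxDr AY BX addr0 add0r.
have XM : (X + Y) *m (A + B) = X *m A + Y *m B.
  by rewrite mulmxDl !mulmxDr XB YA addr0 add0r.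
have MXM : (A + B) *m (X + Y) *m (A + B) = A + B.
  rewrite MX mulmxDl !mulmxDr AXA BYB -!mulmxA XB YA !mulmx0.
  by rewrite addr0 add0r.
apply/and4P; split; apply/eqP => //.
- rewrite XM mulmxDl !mulmxDr XAX YBY -!mulmxA AY BX !mulmx0.
  by rewrite addr0 add0r.
- by rewrite MX ctrmxD hAX hBY.
- by rewrite eXY; apply: mulmx_ctr_idem_herm; rewrite -eXY.
Qed.

Lemma mpinv_add_ortho {m n} (A B : 'M[C]_(m, n)) :
    A ^t* *m B = 0 -> colspace (A ^t*) `&` colspace (B ^t*) = [set 0] ->
  mpinv (A + B) =
    mpinv (A *m mpcoproj (B ^t*)) + mpinv (B *m mpcoproj (A ^t*)).
Proof.
move=> AB0 capAB; have BA0 := ctr_orthoC _ _ AB0.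
have capBA := capAB; rewrite setIC in capBA.
(* Both summands get the same left factor [(A + B) ^t*], so their cofactors add up to the required
   [W]. *)
have [W1 e1] := mpinv_restr_ctr_factor _ _ BA0; rewrite addrC in e1.
have [W2 e2] := mpinv_restr_ctr_factor _ _ AB0.
apply/mpinv_eq/(@is_mpinv_add _ _ _ _ _ _ (W1 + W2)).
- exact: mulmx_mpinv_restr0.
- exact: mulmx_mpinv_restr0.
- exact: mpinv_restr_mulmx0.
- exact: mpinv_restr_mulmx0.
- by rewrite mulmx_mpinv_restr mulmx_mpinv_restrK.
- by rewrite mulmx_mpinv_restr mulmx_mpinv_restrK.
- by rewrite -mulmxA mulmx_mpinv_restr mulmxA mpinv_mulmxK.
- by rewrite -mulmxA mulmx_mpinv_restr mulmxA mpinv_mulmxK.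
- by rewrite mulmx_mpinv_restr mulmx_mpinv_ctr.
- by rewrite mulmx_mpinv_restr mulmx_mpinv_ctr.
- by rewrite mulmxDr -e1 -e2.
Qed.

Lemma mpinv_add_ortho_gram {m n} (A B : 'M[C]_(m, n)) :
    A ^t* *m B = 0 -> colspace (A ^t*) `&` colspace (B ^t*) = [set 0] ->
  mpinv (A + B) =
    (mpinv ((mpcoproj (A ^t*) *m B ^t*) *m (mpcoproj (A ^t*) *m B ^t*) ^t*)
     + mpinv ((mpcoproj (B ^t*) *m A ^t*) *m (mpcoproj (B ^t*) *m A ^t*) ^t*))
    *m (A + B) ^t*.
Proof.
move=> AB0 cap; rewrite (mpinv_add_ortho _ _ AB0 cap) mulmxDl.
rewrite [RHS]addrC; congr (_ + _); last exact/esym/mpinv_gram_restr.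
by have := mpinv_gram_restr B A; rewrite (addrC B).
Qed.

End MoorePenroseTheory.

Theorem theorem2p23 (R : realType) (m n : nat) (A B : 'M[R[i]]_(m, n))
  (hAB : A ^t* *m B = 0)
  (hcap : colspace (A ^t*) `&` colspace (B ^t*) = [set 0]) :
  mpinv (A + B) =
    (mpinv ((mpcoproj (A ^t*) *m B ^t*) *m (mpcoproj (A ^t*) *m B ^t*) ^t*)
     + mpinv ((mpcoproj (B ^t*) *m A ^t*) *m (mpcoproj (B ^t*) *m A ^t*) ^t*))
    *m (A + B) ^t*.
Proof.
exact: mpinv_add_ortho_gram.
Qed.
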